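(* Let $\alpha,\beta,\gamma\in\widehat{\kappa^*}$ satisfy $(\alpha,\beta+\gamma)=(\beta,\gamma)=0$, and let $f\colon\widehat{\kappa^*}\to\mathbb{C}$ be any map. For all $x,y\in\kappa$ with $x\ne0,1$, \[ \sum_{\nu,\mu\in\widehat{\kappa^*}}f(\mu)\frac{(\alpha)_{\nu\mu}(\gamma)_{\nu\mu}}{(\beta)^\circ_{\nu\mu}(\varepsilon)^\circ_\nu(\varepsilon)^\circ_\mu}\nu(x)\mu(y)=\overline{\alpha}(1-x)\sum_{\eta\in\widehat{\kappa^*}}\frac{(\alpha+\beta\overline{\gamma})_\eta}{(\beta+\varepsilon)^\circ_\eta}\eta\!\left(\frac{x}{x-1}\right)\sum_{\mu\in\widehat{\kappa^*}}f(\mu)\frac{(\overline{\eta}+\gamma)_\mu}{(\varepsilon+\gamma\overline{\beta\eta})^\circ_\mu}\mu\!\left(-\frac yx\right) -(1-q)^2f(\overline{\gamma})\frac{(\varepsilon)^\circ_\beta}{(\overline{\alpha})^\circ_\beta}\overline{\beta}\gamma(-x)\,\overline{\gamma}(y)\,\overline{\alpha}\beta(1-x). \]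
   Context: $\kappa$ is a finite field with $q$ elements; $\widehat{\kappa^*}=\mathrm{Hom}(\kappa^*,\mathbb{C}^* )$, written multiplicatively, characters extended by $\varphi(0)=0$; $\varepsilon$ trivial, $\overline{\varphi}=\varphi^{-1}$ (e.g. $\overline{\beta\eta}=(\beta\eta)^{-1}$). $\delta(\varphi)=1$ if $\varphi=\varepsilon$, else $0$. Fix a nontrivial additive character $\psi$; $g(\varphi)=-\sum_{x\in\kappa}\varphi(x)\psi(x)$, $g^\circ(\varphi)=q^{\delta(\varphi)}g(\varphi)$, $(\varphi)_\nu=g(\varphi\nu)/g(\varphi)$, $(\varphi)^\circ_\nu=g^\circ(\varphi\nu)/g^\circ(\varphi)$. $P$ is the free abelian monoid on $\widehat{\kappa^*}$ written additively, with symmetric bilinear pairing determined by $(\alpha,\beta)=\delta(\alpha\overline\beta)$ (so $(\alpha,\beta+\gamma)=0$ means $\alpha\ne\beta,\gamma$). For $\mathbf a=\alpha_1+\dots+\alpha_r$, $(\mathbf a)_\nu=\prod(\alpha_i)_\nu$, $(\mathbf a)^\circ_\nu=\prod(\alpha_i)^\circ_\nu$. *)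

(* Defs.v *)
From HB Require Import structures.
From mathcomp Require Import all_boot all_order all_algebra all_fingroup all_field.
From mathcomp Require Export reals complex.

Set Implicit Arguments.
Unset Strict Implicit.
Unset Printing Implicit Defensive.

Import GRing.Theory.
Local Open Scope ring_scope.

(* A homomorphism kappa^* -> C^*, represented by its extension by zero to     *)
(* kappa.  Values at nonzero points are automatically nonzero. The trivial    *)
(* character is therefore the indicator function of kappa^*, not the constant *)
(* 1.                                                                         *)
Definition mulchar_axiom (F : finFieldType) (C : numClosedFieldType)
    (f : {ffun F -> C}) : bool :=
  [&& f 0 == 0, f 1 == 1 & [forall x, forall y, f (x * y) == f x * f y]].

Record mulchar (F : finFieldType) (C : numClosedFieldType) : predArgType :=
  MulChar { mulchar_val :> {ffun F -> C}; _ : mulchar_axiom mulchar_val }.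

HB.instance Definition _ F C := [isSub for @mulchar_val F C].
HB.instance Definition _ F C := [Choice of mulchar F C by <:].

Section MulCharGroup.
Variables (F : finFieldType) (C : numClosedFieldType).
Implicit Types (f : {ffun F -> C}) (phi chi : mulchar F C).

Lemma mulchar_axiomP f :
  reflect [/\ f 0 = 0, f 1 = 1 & forall x y, f (x * y) = f x * f y]
          (mulchar_axiom f).
Proof.
apply: (iffP and3P) => [[/eqP f0 /eqP f1 /forallP fM] | [-> -> fM]].
  by split=> // x y; apply/eqP; have /forallP := fM x; apply.
by split=> //; apply/forallP=> x; apply/forallP=> y; rewrite fM.
Qed.

Lemma mulchar0 phi : phi 0 = 0.
Proof. by have /mulchar_axiomP[] := valP phi. Qed.

Lemma mulchar1 phi : phi 1 = 1.
Proof. by have /mulchar_axiomP[] := valP phi. Qed.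

Lemma mulcharM phi x y : phi (x * y) = phi x * phi y.
Proof. by have /mulchar_axiomP[_ _] := valP phi; apply. Qed.

Lemma mulcharX phi x n : phi (x ^+ n) = phi x ^+ n.
Proof.
by elim: n => [|n IHn]; rewrite ?expr0 ?mulchar1 // !exprS mulcharM IHn.
Qed.

Lemma mulchar_neq0 phi x : x != 0 -> phi x != 0.
Proof.
move=> x0; apply/eqP=> fx0; have /eqP := mulchar1 phi.
by rewrite -(divff x0) mulcharM fx0 mul0r eq_sym oner_eq0.
Qed.

Lemma mulcharP phi chi : (forall x, phi x = chi x) -> phi = chi.
Proof. by move=> e; apply/val_inj/ffunP. Qed.

Lemma mulchar_one_subproof :
  mulchar_axiom [ffun x : F => (x != 0)%:R : C].
Proof.
apply/mulchar_axiomP; split=> [||x y]; rewrite !ffunE ?eqxx ?oner_eq0 //.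
by rewrite mulf_eq0 negb_or -natrM mulnb.
Qed.
Definition mulchar_one := MulChar mulchar_one_subproof.

Lemma mulchar_mul_subproof phi chi :
  mulchar_axiom [ffun x => phi x * chi x].
Proof.
apply/mulchar_axiomP; split=> [||x y]; rewrite !ffunE ?mulchar0 ?mulchar1;
  by rewrite ?mul0r ?mul1r // !mulcharM mulrACA.
Qed.
Definition mulchar_mul phi chi := MulChar (mulchar_mul_subproof phi chi).

Lemma mulchar_inv_subproof phi : mulchar_axiom [ffun x => (phi x)^-1].
Proof.
apply/mulchar_axiomP; split=> [||x y]; rewrite !ffunE ?mulchar0 ?mulchar1;
  by rewrite ?invr0 ?invr1 // mulcharM invfM.
Qed.
Definition mulchar_inv phi := MulChar (mulchar_inv_subproof phi).

Lemma mulchar_mulA : associative mulchar_mul.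
Proof. by move=> a b c; apply: mulcharP => x; rewrite !ffunE mulrA. Qed.

Lemma mulchar_mulC : commutative mulchar_mul.
Proof. by move=> a b; apply: mulcharP => x; rewrite !ffunE mulrC. Qed.

Lemma mulchar_mul1 : left_id mulchar_one mulchar_mul.
Proof.
move=> a; apply: mulcharP => x; rewrite !ffunE.
by case: eqP => [->|_]; rewrite ?mulchar0 ?mulr0 ?mul1r.
Qed.

Lemma mulchar_mulV : left_inverse mulchar_one mulchar_inv mulchar_mul.
Proof.
move=> a; apply: mulcharP => x; rewrite !ffunE.
have [->|x0] := eqVneq x 0; first by rewrite mulchar0 mulr0.
by rewrite mulVf ?mulchar_neq0.
Qed.

Lemma mulchar_mulr1 : right_id mulchar_one mulchar_mul.
Proof. by move=> a; rewrite mulchar_mulC mulchar_mul1. Qed.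

Lemma mulchar_mulrV : right_inverse mulchar_one mulchar_inv mulchar_mul.
Proof. by move=> a; rewrite mulchar_mulC mulchar_mulV. Qed.

HB.instance Definition _ := isGroup.Build (mulchar F C)
  mulchar_mulA mulchar_mul1 mulchar_mulr1 mulchar_mulV mulchar_mulrV.

(* Finiteness: every value of a character is a root of 'X^#|F| - 'X. *)
Definition mulchar_values : seq C :=
  sval (closed_field_poly_normal ('X^#|F| - 'X : {poly C})).

Lemma mem_mulchar_values phi x : phi x \in mulchar_values.
Proof.
have q1 := finNzRing_gt1 F.
rewrite /mulchar_values; case: closed_field_poly_normal => r /= Dr.
have sz : size ('X^#|F| - 'X : {poly C}) = #|F|.+1.
  by rewrite size_polyDl ?size_polyXn // size_polyN size_polyX.
have p0 : ('X^#|F| - 'X : {poly C}) != 0 by rewrite -size_poly_eq0 sz.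
have: root ('X^#|F| - 'X) (phi x).
  by rewrite rootE !hornerE ?hornerXn -mulcharX expf_card subrr.
by rewrite Dr rootZ ?lead_coef_eq0 // root_prod_XsubC.
Qed.

Definition mulchar_code phi : {ffun F -> 'I_(size mulchar_values).+1} :=
  [ffun x => inord (index (phi x) mulchar_values)].

Definition mulchar_decode (k : {ffun F -> 'I_(size mulchar_values).+1}) :
    option (mulchar F C) :=
  insub [ffun x => nth 0 mulchar_values (k x)].

Lemma mulchar_codeK : pcancel mulchar_code mulchar_decode.
Proof.
move=> phi; rewrite /mulchar_decode.
suff -> : [ffun x => nth 0 mulchar_values (mulchar_code phi x)] = val phi.
  by rewrite valK.
apply/ffunP=> x; rewrite !ffunE inordK ?ltnS ?index_size //.
by rewrite nth_index ?mem_mulchar_values.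
Qed.

HB.instance Definition _ : isCountable (mulchar F C) :=
  PCanIsCountable mulchar_codeK.
HB.instance Definition _ : isFinite (mulchar F C) :=
  PCanIsFinite mulchar_codeK.

End MulCharGroup.

Definition additive_char (F : finFieldType) (C : numClosedFieldType)
    (psi : F -> C) : Prop :=
  psi 0 = 1 /\ forall x y, psi (x + y) = psi x * psi y.

Definition nontrivial_additive_char (F : finFieldType)
    (C : numClosedFieldType) (psi : F -> C) : Prop :=
  additive_char psi /\ exists x, psi x != 1.

Definition char_delta (F : finFieldType) (C : numClosedFieldType)
    (phi : mulchar F C) : nat := (phi == 1%g).

Section GaussSums.
Variables (F : finFieldType) (C : numClosedFieldType) (psi : F -> C).
Implicit Types phi nu : mulchar F C.

Definition gauss phi : C := - \sum_(x : F) phi x * psi x.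

(* The suffix o stands for the superscript circle. *)
Definition gausso phi : C := #|F|%:R ^+ char_delta phi * gauss phi.

Definition poch1 phi nu : C := gauss (phi * nu)%g / gauss phi.

Definition pocho1 phi nu : C := gausso (phi * nu)%g / gausso phi.

End GaussSums.

(* The free abelian monoid on the finite set of characters: an element is its *)
(* multiplicity function, and addition is the pointwise one of {ffun _}.      *)
Notation charmon F C := {ffun mulchar F C -> nat}.

Section CharMonoid.
Variables (F : finFieldType) (C : numClosedFieldType).
Implicit Types (phi nu : mulchar F C) (a b c : charmon F C).

Definition chargen phi : charmon F C := [ffun chi => (chi == phi) : nat].

Definition charpair a b : nat :=
  (\sum_(alpha : mulchar F C) \sum_(beta : mulchar F C)
     a alpha * b beta * char_delta (alpha * beta^-1)%g)%N.

Definition poch (psi : F -> C) a nu : C :=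
  \prod_(alpha : mulchar F C) poch1 psi alpha nu ^+ a alpha.

Definition pocho (psi : F -> C) a nu : C :=
  \prod_(alpha : mulchar F C) pocho1 psi alpha nu ^+ a alpha.

Lemma charpairDr a b c : charpair a (b + c) = (charpair a b + charpair a c)%N.
Proof.
rewrite /charpair -big_split; apply: eq_bigr => alpha _ /=.
rewrite -big_split; apply: eq_bigr => beta _ /=.
by rewrite !ffunE -!mulnA -mulnDr -mulnDl.
Qed.

Lemma charpair_gen phi nu :
  charpair (chargen phi) (chargen nu) = char_delta (phi * nu^-1)%g.
Proof.
rewrite /charpair (bigD1 phi) //= [X in (_ + X)%N]big1 ?addn0 => [|i /negPf ni].
  rewrite (bigD1 nu) //= [X in (_ + X)%N]big1 ?addn0 => [|j /negPf nj].
    by rewrite !ffunE !eqxx !mul1n.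
  by rewrite !ffunE nj muln0.
by apply: big1 => j _; rewrite !ffunE ni.
Qed.

Lemma pochD psi a b nu : poch psi (a + b) nu = poch psi a nu * poch psi b nu.
Proof.
by rewrite /poch -big_split; apply: eq_bigr => i _; rewrite ffunE exprD.
Qed.

Lemma poch_gen psi phi nu : poch psi (chargen phi) nu = poch1 psi phi nu.
Proof.
rewrite /poch (bigD1 phi) //= big1 ?mulr1 => [|i /negPf ni].
  by rewrite ffunE eqxx.
by rewrite ffunE ni.
Qed.

Lemma pochoD psi a b nu :
  pocho psi (a + b) nu = pocho psi a nu * pocho psi b nu.
Proof.
by rewrite /pocho -big_split; apply: eq_bigr => i _; rewrite ffunE exprD.
Qed.

Lemma pocho_gen psi phi nu : pocho psi (chargen phi) nu = pocho1 psi phi nu.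
Proof.
rewrite /pocho (bigD1 phi) //= big1 ?mulr1 => [|i /negPf ni].
  by rewrite ffunE eqxx.
by rewrite ffunE ni.
Qed.

End CharMonoid.

(* Main.v *)
Require Import Defs.
From mathcomp Require Import all_boot all_order all_algebra all_fingroup.
From mathcomp Require Import reals complex.
From mathcomp Require Import all_solvable all_field ring.

Set Implicit Arguments.
Unset Strict Implicit.
Unset Printing Implicit Defensive.

Import GRing.Theory Num.Theory.
Local Open Scope ring_scope.

(* Comparing coefficients of f(mu), both sides are the same multiple of Gauss
   hypergeometric sums 2F1 with parameters A = alpha mu, D = gamma mu and
   B = beta mu, and the identity becomes Pfaff's transformation
     2F1(A, D; B; x) = A^-1(1-x) 2F1(A, B/D; B; x/(x-1)).
   Fourier expansion of psi over the multiplicative characters expresses 2F1 as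
   the Euler type sum of D(a) G_{D/B}(1+a) G_A(1+ax) over a, where G_phi(z) is
   the Gauss sum of phi twisted by z, and the substitution a -> -1-a gives
   Pfaff's transformation.  It fails exactly for D = 1, i.e. mu = gamma^-1, and
   the defect is a Jacobi sum, which is the last term of the theorem. *)

(** * Primitive roots of unity in [C] and in the finite field *)

Lemma closed_prim_root_exists (C : numClosedFieldType) n :
  (0 < n)%N -> exists z : C, n.-primitive_root z.
Proof.
move=> n_gt0; have [r] := closed_field_poly_normal ('X^n - 1 : {poly C}).
rewrite (monicP (monicXnsubC 1 n_gt0)) scale1r => Xn1.
suff /hasP[z _ z_prim] : has n.-primitive_root r by exists z.
apply: has_prim_root => //.
- by apply/allP=> z rz; rewrite /root_of_unity Xn1 root_prod_XsubC.
- rewrite -separable_prod_XsubC -Xn1 separable_Xn_sub_1 //.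
  by rewrite pnatr_eq0 -lt0n.
- by rewrite -ltnS -(size_prod_XsubC r id) -Xn1 size_XnsubC.
Qed.

Lemma expf_pred_card (F : finFieldType) (x : F) : x != 0 -> x ^+ #|F|.-1 = 1.
Proof.
move=> x0; apply: (mulfI x0); rewrite mulr1 -exprS prednK ?expf_card //.
exact: ltnW (finNzRing_gt1 F).
Qed.

Lemma finField_prim_root (F : finFieldType) :
  exists z : F, (#|F|.-1).-primitive_root z.
Proof.
pose r := enum (predC1 (0 : F)).
suff /hasP[z _ z_prim] : has (#|F|.-1).-primitive_root r by exists z.
apply: has_prim_root; rewrite ?enum_uniq //.
- by rewrite -ltnS prednK ?finNzRing_gt1 // ltnW ?finNzRing_gt1.
- apply/allP=> z; rewrite mem_enum inE => z0.
  by apply/unity_rootP; apply: expf_pred_card.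
- by rewrite -cardE cardC1.
Qed.

(** * Multiplicative characters and their two orthogonality relations *)

Section Characters.
Variables (F : finFieldType) (C : numClosedFieldType).
Implicit Types (phi chi nu : mulchar F C) (x y z : F).

Local Notation q := (#|F|%:R : C).

Lemma mulcharE phi chi x : (phi * chi)%g x = phi x * chi x.
Proof. by rewrite ffunE. Qed.

Lemma mulcharVE phi x : (phi^-1)%g x = (phi x)^-1.
Proof. by rewrite ffunE. Qed.

Lemma mulchar1E x : (1%g : mulchar F C) x = (x != 0)%:R.
Proof. by rewrite ffunE. Qed.

Lemma mulcharV phi x : phi x^-1 = (phi x)^-1.
Proof.
have [->|x0] := eqVneq x 0; first by rewrite invr0 mulchar0 invr0.
apply: (mulfI (mulchar_neq0 phi x0)).
by rewrite -mulcharM !divff ?mulchar1 ?mulchar_neq0.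
Qed.

Lemma mulcharN1_sqr phi : phi (-1) * phi (-1) = 1.
Proof. by rewrite -mulcharM mulrNN mulr1 mulchar1. Qed.

Lemma mulcharN phi x : phi (- x) = phi (-1) * phi x.
Proof. by rewrite -mulcharM mulN1r. Qed.

Lemma mulcharC phi chi : (phi * chi = chi * phi)%g.
Proof. exact: mulchar_mulC. Qed.

Lemma card_pred_natr : #|F|.-1%:R = q - 1.
Proof. by rewrite -subn1 natrB // ltnW // finNzRing_gt1. Qed.

Lemma card_neq0 : q != 0.
Proof. by rewrite pnatr_eq0 -lt0n ltnW // finNzRing_gt1. Qed.

(** A generator [w] of the multiplicative group and a root of unity [u] of the same order give the
    injective character w^i -> u^i, which separates every [z] from 1. *)
Lemma exists_mulchar_neq1 z : z != 0 -> z != 1 -> exists nu, nu z != 1.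
Proof.
have [w w_prim] := finField_prim_root F.
have n_gt0 := prim_order_gt0 w_prim.
have [u u_prim] := closed_prim_root_exists C n_gt0.
have wn0 : w != 0.
  apply/eqP=> w0; have /eqP := prim_expr_order w_prim.
  by rewrite w0 expr0n gtn_eqF // eq_sym oner_eq0.
(* Discrete logarithm to base [w]; the default value is reached only at [x = 0], where [h] is set to
   0 separately. *)
pose log x : 'I_#|F|.-1 :=
  odflt (Ordinal n_gt0) [pick i : 'I_#|F|.-1 | w ^+ i == x].
have logP x : x != 0 -> w ^+ log x = x.
  move=> x0; rewrite /log; case: pickP => [i /eqP //|no].
  have [i xi] := prim_rootP w_prim (expf_pred_card x0).
  by have := no i; rewrite -xi eqxx.
pose h := [ffun x : F => if x == 0 then 0 else u ^+ log x].
have hpow i : h (w ^+ i) = u ^+ i.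
  rewrite ffunE expf_eq0 (negbTE wn0) andbF.
  apply/eqP; rewrite (eq_prim_root_expr u_prim) -(eq_prim_root_expr w_prim).
  by rewrite logP // expf_neq0.
have hchar : mulchar_axiom h.
  apply/mulchar_axiomP; split=> [||x y]; first by rewrite ffunE eqxx.
    by rewrite -(expr0 w) hpow.
  have [->|x0] := eqVneq x 0; first by rewrite mul0r !ffunE eqxx mul0r.
  have [->|y0] := eqVneq y 0; first by rewrite mulr0 !ffunE eqxx mulr0.
  by rewrite -(logP x x0) -(logP y y0) -exprD !hpow exprD.
move=> z0 z1; exists (MulChar hchar) => /=; apply: contra z1 => hz1.
rewrite -(logP z z0) -(expr0 w) (eq_prim_root_expr w_prim).
by rewrite -(eq_prim_root_expr u_prim) -hpow logP ?expr0.
Qed.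

Lemma sum_mulchar phi : \sum_x phi x = (phi == 1%g)%:R * (q - 1).
Proof.
have [->|phi1] := eqVneq phi 1%g.
  under eq_bigr do rewrite mulchar1E.
  rewrite mul1r (bigD1 0) //= eqxx add0r.
  rewrite (eq_bigr (fun=> 1)) => [|x /= ->] //.
  by rewrite sumr_const cardC1 card_pred_natr.
have [z z0 phiz] : exists2 z, z != 0 & phi z != 1.
  have [/existsP[z /andP[]]|] := boolP [exists z, (z != 0) && (phi z != 1)].
    by exists z.
  rewrite negb_exists => /forallP no; case/eqP: phi1; apply: mulcharP => z.
  rewrite mulchar1E; have [->|z0] := eqVneq z 0; first by rewrite mulchar0.
  by have := no z; rewrite z0 /= negbK => /eqP.
rewrite mul0r; apply/eqP; set S := \sum_x _.
have : phi z * S = S.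
  rewrite mulr_sumr [RHS](reindex_inj (mulfI z0)).
  by apply: eq_bigr => x _; rewrite mulcharM.
move/eqP; rewrite -subr_eq0 -{2}(mul1r S) -mulrBl mulf_eq0 subr_eq0.
by rewrite (negbTE phiz).
Qed.

Lemma sum_mulchar_dual z :
  \sum_(nu : mulchar F C) nu z = (z == 1)%:R * (q - 1).
Proof.
have sum0 y : y != 1 -> \sum_(nu : mulchar F C) nu y = 0.
  move=> y1; have [->|y0] := eqVneq y 0.
    by apply: big1 => nu _; rewrite mulchar0.
  have [chi chiy] := exists_mulchar_neq1 y0 y1.
  apply/eqP; set S := \sum_nu _.
  have : chi y * S = S.
    rewrite mulr_sumr [RHS](reindex_inj (mulgI chi)).
    by apply: eq_bigr => nu _; rewrite mulcharE.
  move/eqP; rewrite -subr_eq0 -{2}(mul1r S) -mulrBl mulf_eq0 subr_eq0.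
  by rewrite (negbTE chiy).
have [->|z1] := eqVneq z 1; last by rewrite sum0 ?mul0r.
(* The case [z = 1] counts the characters. Since the sums at y <> 1 vanish, the count is the sum
   over all pairs (y, nu), and summing over y first leaves only the trivial character. *)
rewrite mul1r.
transitivity (\sum_(y : F) \sum_(nu : mulchar F C) nu y).
  by rewrite [RHS](bigD1 1) //= [X in _ + X]big1 ?addr0 // => y /sum0.
rewrite exchange_big; under eq_bigr do rewrite sum_mulchar.
by rewrite -mulr_suml -natr_sum -big_mkcond /= big_pred1_eq mul1r.
Qed.

End Characters.

(** * Gauss sums: twisting, reflection and Fourier expansion of [psi] *)

Section GaussSumTheory.
Variables (F : finFieldType) (C : numClosedFieldType) (psi : F -> C).
Hypothesis hpsi : nontrivial_additive_char psi.
Implicit Types (phi nu : mulchar F C) (x y z : F).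

Local Notation q := (#|F|%:R : C).
Local Notation g := (gauss psi).
Local Notation go := (gausso psi).

Lemma addchar0 : psi 0 = 1. Proof. by case: hpsi => [[]]. Qed.

Lemma addcharD x y : psi (x + y) = psi x * psi y.
Proof. by case: hpsi => [[]]. Qed.

Lemma sum_addchar z : \sum_x psi (x * z) = (z == 0)%:R * q.
Proof.
have [->|z0] := eqVneq z 0.
  under eq_bigr do rewrite mulr0 addchar0.
  by rewrite sumr_const mul1r.
have [_ [y psiy]] := hpsi.
rewrite mul0r -(reindex_inj (P := predT) (F := psi) (mulIf z0)).
apply/eqP; set S := \sum_x _.
have : psi y * S = S.
  rewrite mulr_sumr [RHS](reindex_inj (addrI y)).
  by apply: eq_bigr => x _; rewrite addcharD.
move/eqP; rewrite -subr_eq0 -{2}(mul1r S) -mulrBl mulf_eq0 subr_eq0.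
by rewrite (negbTE psiy).
Qed.

Lemma sum_nonzero_addchar z :
  \sum_x (x != 0)%:R * psi (x * z) = (z == 0)%:R * q - 1.
Proof.
rewrite -sum_addchar [in RHS](bigD1 0) //= mul0r addchar0 [RHS]addrC addKr.
rewrite (bigD1 0) //= eqxx mul0r add0r.
by apply: eq_bigr => x ->; rewrite mul1r.
Qed.

Definition gausst phi z : C := - \sum_x phi x * psi (x * z).

Lemma gausst1 phi : gausst phi 1 = g phi.
Proof. by congr (- _); apply: eq_bigr => x _; rewrite mulr1. Qed.

Lemma gausstM phi u z :
  u != 0 -> gausst phi (u * z) = (phi u)^-1 * gausst phi z.
Proof.
move=> u0; rewrite /gausst mulrN mulr_sumr; congr (- _).
rewrite [RHS](reindex_inj (mulIf u0)); apply: eq_bigr => x _.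
rewrite mulcharM -[x * u * z]mulrA [phi x * phi u]mulrC !mulrA mulVf ?mul1r //.
exact: mulchar_neq0.
Qed.

Lemma gausst0 phi : gausst phi 0 = (phi == 1%g)%:R * (1 - q).
Proof.
rewrite /gausst; under eq_bigr do rewrite mulr0 addchar0 mulr1.
by rewrite sum_mulchar -mulrN opprB.
Qed.

(** Homogeneity covers z <> 0. At [z = 0] the first term vanishes because [0^-1 = 0], and the second
    supplies the value, nonzero only for trivial [phi]; this term is the source of the exceptional
    case of Pfaff's transformation. *)
Lemma gausstE phi z :
  gausst phi z = (phi z)^-1 * g phi + (z == 0)%:R * (phi == 1%g)%:R * (1 - q).
Proof.
have [->|z0] := eqVneq z 0.
  by rewrite mulchar0 invr0 gausst0 mul0r add0r mul1r.
by rewrite -{1}(mulr1 z) gausstM // gausst1 !mul0r addr0.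
Qed.

Lemma gauss1 : g 1%g = 1.
Proof.
rewrite -gausst1 /gausst; under eq_bigr do rewrite mulchar1E.
by rewrite sum_nonzero_addchar oner_eq0 mul0r add0r opprK.
Qed.

Lemma gausso1 : go 1%g = q.
Proof. by rewrite /gausso /char_delta eqxx expr1 gauss1 mulr1. Qed.

Lemma gausso_neq1 phi : phi != 1%g -> go phi = g phi.
Proof. by move=> /negPf phi1; rewrite /gausso /char_delta phi1 expr0 mul1r. Qed.

(** Reflection formula. The factor q carried by [go] at the trivial character makes it hold with no
    exception. *)
Lemma gauss_gaussoV phi : g phi * go (phi^-1)%g = phi (-1) * q.
Proof.
have [->|phi1] := eqVneq phi 1%g.
  rewrite invg1 gauss1 gausso1 mulchar1E mul1r.
  by rewrite oppr_eq0 oner_eq0 mul1r.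
rewrite gausso_neq1 ?eq_invg1 //.
have -> : g phi * g (phi^-1)%g =
    \sum_y (phi^-1)%g y * psi y * \sum_x phi x * psi x.
  by rewrite -mulr_suml /gauss mulrNN mulrC.
(* Substitute x = y t. The inner sum is then q [t = -1] - 1, and the -1 disappears by orthogonality
   since [phi] is nontrivial. *)
transitivity (\sum_t phi t * \sum_y (y != 0)%:R * psi (y * (1 + t))).
  rewrite (eq_bigr (fun y => \sum_t phi t * ((y != 0)%:R * psi (y * (1 + t))))).
    by rewrite exchange_big; apply: eq_bigr => t _; rewrite mulr_sumr.
  move=> y _; have [->|y0] := eqVneq y 0.
    by rewrite mulchar0 !mul0r big1 // => t _; rewrite mul0r mulr0.
  rewrite mulr_sumr (reindex_inj (mulfI y0)); apply: eq_bigr => t _.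
  rewrite mulrDr mulr1 addcharD mul1r mulcharM mulcharVE.
  by field; rewrite mulchar_neq0.
under eq_bigr do rewrite sum_nonzero_addchar mulrBr mulr1.
rewrite sumrB sum_mulchar (negbTE phi1) mul0r subr0.
rewrite (bigD1 (-1)) //= subrr eqxx mul1r big1 ?addr0 // => t t1.
by rewrite addrC addr_eq0 (negbTE t1) mul0r mulr0.
Qed.

Lemma gauss_neq0 phi : g phi != 0.
Proof.
have : g phi * go (phi^-1)%g != 0.
  rewrite gauss_gaussoV mulf_neq0 ?card_neq0 ?mulchar_neq0 //.
  by rewrite oppr_eq0 oner_eq0.
by apply: contraNneq => ->; rewrite mul0r.
Qed.

Lemma gausso_neq0 phi : go phi != 0.
Proof. by rewrite mulf_neq0 ?gauss_neq0 // expf_neq0 ?card_neq0. Qed.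

Lemma gaussoE phi : go phi = phi (-1) * q / g (phi^-1)%g.
Proof.
apply: (mulIf (gauss_neq0 (phi^-1)%g)); rewrite divfK ?gauss_neq0 //.
rewrite mulrC -{2}[phi]invgK gauss_gaussoV mulcharVE; congr (_ * _).
by rewrite -mulcharV invrN1.
Qed.

(** Fourier inversion on the multiplicative group: after opening the Gauss sums, the sum over [nu]
    of nu(w/d) selects d = w. *)
Lemma addchar_fourier w : w != 0 ->
  (q - 1) * psi w = - \sum_(nu : mulchar F C) g (nu^-1)%g * nu w.
Proof.
move=> w0; rewrite -sumrN.
rewrite (eq_bigr (fun nu : mulchar F C => \sum_d psi d * nu (w / d))).
  rewrite exchange_big /= (bigD1 w) //.
  rewrite [X in _ = _ + X]big1 ?addr0 => [|d /= dw].
    by rewrite -mulr_sumr sum_mulchar_dual divff // eqxx mul1r mulrC.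
  rewrite -mulr_sumr sum_mulchar_dual; have [->|d0] := eqVneq d 0.
    by rewrite invr0 mulr0 eq_sym oner_eq0 mul0r mulr0.
  case: eqP => [wd|]; last by rewrite mul0r mulr0.
  by case/eqP: dw; rewrite -[d]mul1r -wd divfK.
move=> nu _; rewrite /gauss mulNr opprK mulr_suml; apply: eq_bigr => d _.
by rewrite mulcharVE mulcharM mulcharV; ring.
Qed.

End GaussSumTheory.

(** * Hypergeometric sums 2F1, their Euler sums, and Pfaff's transformation *)

Section Hypergeometric.
Variables (F : finFieldType) (C : numClosedFieldType) (psi : F -> C).
Hypothesis hpsi : nontrivial_additive_char psi.
Implicit Types (phi chi nu mu eta A B D : mulchar F C) (x y z : F).

Local Notation q := (#|F|%:R : C).
Local Notation g := (gauss psi).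
Local Notation go := (gausso psi).
Local Notation gt := (gausst psi).

Lemma mulcharN1V phi : (phi (-1))^-1 = phi (-1).
Proof. by rewrite -mulcharV invrN1. Qed.

Lemma gaussoV phi : (go phi)^-1 = phi (-1) * g (phi^-1)%g / q.
Proof. by rewrite gaussoE // invfM invrK invfM mulcharN1V mulrAC. Qed.

Definition hyp2F1 A D B x : C :=
  \sum_nu poch1 psi A nu * poch1 psi D nu
     / (pocho1 psi B nu * pocho1 psi 1%g nu)
     * nu x.

Lemma mul_sum3 (I J K : finType) (f1 : I -> C) (f2 : J -> C) (f3 : K -> C) :
  (\sum_i f1 i) * (\sum_j f2 j) * (\sum_k f3 k) =
  \sum_k \sum_j \sum_i f1 i * f2 j * f3 k.
Proof.
rewrite mulr_sumr; apply: eq_bigr => k _; rewrite mulr_sumr mulr_suml.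
by apply: eq_bigr => j _; rewrite !mulr_suml.
Qed.

(** Twisted Gauss sums stand in for the powers of 1 + a and 1 + ax in Euler's integral. They replace
    plain characters so that [hyp2F1E] holds for all [A], [D], [B]. *)
Definition euler_sum A D B x : C :=
  \sum_a D a * gt (D * B^-1)%g (1 + a) * gt A (1 + a * x).

Lemma euler_sum_fourier A D B x : x != 0 ->
  (q - 1) * euler_sum A D B x =
  \sum_nu g (A * nu)%g * g (D * nu)%g * g ((B * nu)^-1)%g * g (nu^-1)%g * nu x.
Proof.
move=> x0.
transitivity (\sum_c \sum_a \sum_b
   D a * A b * (B c)^-1 * psi c * psi a * psi b
     * ((q - 1) * psi (a * b * x / c))).
  rewrite mulr_sumr /gausst.
  transitivity (\sum_a \sum_c \sum_b (q - 1) * (D a * (D c / B c *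
      psi (c * (1 + a))) * (A b * psi (b * (1 + a * x))))).
    apply: eq_bigr => a _; rewrite !(mulrN, mulNr) opprK.
    rewrite [D a * _]mulr_sumr mulr_suml mulr_sumr; apply: eq_bigr => c _.
    rewrite !mulr_sumr; apply: eq_bigr => b _.
    by rewrite mulcharE mulcharVE.
  rewrite exchange_big; apply: eq_bigr => c _ /=.
  have [->|c0] := eqVneq c 0.
    rewrite big1 => [|a _]; last first.
      by rewrite big1 // => b _; rewrite mulchar0 !(mulr0, mul0r).
    rewrite big1 // => a _; rewrite big1 // => b _.
    by rewrite mulchar0 invr0 !(mulr0, mul0r).
  have cV0 : c^-1 != 0 by rewrite invr_eq0.
  (* Replacing a by a/c turns the total argument of [psi] into c + a + b + abx/c, so only the last
     summand couples the variables. *)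
  rewrite (reindex_inj (mulIf cV0)); apply: eq_bigr => a _.
  apply: eq_bigr => b _.
  have -> : c * (1 + a / c) = c + a by field.
  rewrite mulcharM mulcharV.
  have -> : b * (1 + a / c * x) = b + a * b * x / c by field.
  rewrite !(addcharD hpsi); field.
  by rewrite !mulchar_neq0.
(* The coupling factor psi(abx/c) is expanded over characters. This needs a, b, c nonzero; the other
   terms vanish on both sides. *)
transitivity (\sum_c \sum_a \sum_b \sum_nu
   - ((A * nu)%g b * psi b * ((D * nu)%g a * psi a)
      * (((B * nu)^-1)%g c * psi c) * g (nu^-1)%g * nu x)).
  apply: eq_bigr => c _; apply: eq_bigr => a _; apply: eq_bigr => b _.
  have [->|c0] := eqVneq c 0.
    rewrite mulchar0 invr0 !(mulr0, mul0r) big1 // => nu _.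
    by rewrite mulchar0 !(mulr0, mul0r) oppr0.
  have [->|a0] := eqVneq a 0.
    rewrite mulchar0 !(mulr0, mul0r) big1 // => nu _.
    by rewrite mulchar0 !(mulr0, mul0r) oppr0.
  have [->|b0] := eqVneq b 0.
    rewrite mulchar0 !(mulr0, mul0r) big1 // => nu _.
    by rewrite mulchar0 !(mulr0, mul0r) oppr0.
  rewrite addchar_fourier ?mulf_neq0 ?invr_eq0 //.
  rewrite sumrN mulrN mulr_sumr; congr (- _); apply: eq_bigr => nu _.
  rewrite mulcharVE !mulcharE !mulcharM mulcharV invfM; ring.
transitivity (\sum_c \sum_nu \sum_a \sum_b
   - ((A * nu)%g b * psi b * ((D * nu)%g a * psi a)
      * (((B * nu)^-1)%g c * psi c) * g (nu^-1)%g * nu x)).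
  apply: eq_bigr => c _; rewrite [RHS]exchange_big; apply: eq_bigr => a _.
  by rewrite [RHS]exchange_big.
rewrite exchange_big; apply: eq_bigr => nu _.
transitivity ((\sum_c \sum_a \sum_b (A * nu)%g b * psi b
    * ((D * nu)%g a * psi a) * (((B * nu)^-1)%g c * psi c))
    * - (g (nu^-1)%g * nu x)).
  do 3!(rewrite mulr_suml; apply: eq_bigr => ? _).
  by ring.
(* The triple sum factors; the signs of the three Gauss sums cancel the sign of the Fourier
   expansion. *)
rewrite -mul_sum3 [g (A * nu)%g]/gauss [g (D * nu)%g]/gauss.
by rewrite [g ((B * nu)^-1)%g]/gauss; ring.
Qed.

(** Reflection moves the circled Gauss sums of the denominators into the numerator. Each of the two
    brings a factor nu(-1), and these cancel. *)
Lemma hyp2F1E A D B x : x != 0 ->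
  hyp2F1 A D B x =
  B (-1) * (q - 1) / q * go B / (g A * g D) * euler_sum A D B x.
Proof.
move=> x0; have gA := gauss_neq0 hpsi A; have gD := gauss_neq0 hpsi D.
have q0 := card_neq0 F C.
have -> : B (-1) * (q - 1) / q * go B / (g A * g D) * euler_sum A D B x =
    B (-1) / q * go B / (g A * g D) * ((q - 1) * euler_sum A D B x).
  by field; rewrite q0 gA gD.
rewrite euler_sum_fourier // mulr_sumr; apply: eq_bigr => nu _.
rewrite [(pocho1 _ _ _ * _)^-1]invfM /poch1 /pocho1 mul1g gausso1 //.
rewrite !invf_div !gaussoV //.
have nu2 := mulcharN1_sqr nu; rewrite mulcharE.
transitivity (nu (-1) * nu (-1) *
  (g (A * nu)%g / g A * (g (D * nu)%g / g D)
   * (B (-1) * g ((B * nu)^-1)%g / q * go B * g (nu^-1)%g) * nu x)).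
  by field; rewrite q0 gA gD.
by rewrite nu2; field; rewrite q0 gA gD.
Qed.

Lemma mulchar_divr_div B D : (B * (B * D^-1)^-1)%g = D.
Proof. by rewrite invgM invgK mulcharC -mulgA mulVg mulg1. Qed.

(** Euler's integral with genuine characters at a and 1 + a. In contrast to [euler_sum], its term at
    a = -1 vanishes even when D = B. *)
Definition euler_int A D B x : C :=
  \sum_a D a * (B * D^-1)%g (1 + a) * gt A (1 + a * x).

Lemma euler_sumE A D B x : D != B ->
  euler_sum A D B x = g (D * B^-1)%g * euler_int A D B x.
Proof.
move=> DB; rewrite mulr_sumr; apply: eq_bigr => a _.
rewrite (gausstE hpsi (D * B^-1)%g) -eq_mulgV1 (negbTE DB) mulr0 mul0r addr0.
by rewrite !mulcharE !mulcharVE invfM invrK; ring.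
Qed.

(** The substitution a -> -1 - a exchanges the characters at a and 1 + a, while 1 - (1 + a)x = (1 -
    x)(1 + a x/(x - 1)). *)
Lemma euler_int_reflect A D B x : x != 1 ->
  euler_int A D B x =
  B (-1) * (A (1 - x))^-1 * euler_int A (B * D^-1)%g B (x / (x - 1)).
Proof.
move=> x1; have xB1 : x - 1 != 0 by rewrite subr_eq0.
have x1B : 1 - x != 0 by rewrite subr_eq0 eq_sym.
rewrite /euler_int mulchar_divr_div mulr_sumr.
rewrite (reindex_inj (subrI (-1))); apply: eq_bigr => a _.
rewrite -opprD [D _]mulcharN.
have -> : 1 - (1 + a) = - a by ring.
have -> : 1 + - (1 + a) * x = (1 - x) * (1 + a * (x / (x - 1))) by field.
rewrite gausstM // [(B * D^-1)%g (- a)]mulcharN [(B * D^-1)%g (-1)]mulcharE.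
by rewrite mulcharVE; field; rewrite !mulchar_neq0 // oppr_eq0 oner_eq0.
Qed.

(** D <> B and D <> 1 allow passing from [euler_sum] to [euler_int] on the left and on the right
    respectively. After reflecting g(D/B) and g(1/D), both constants are multiples of 1/(g(D)
    g(B/D)). *)
Lemma hyp2F1_pfaff A D B x : x != 0 -> x != 1 -> D != 1%g -> D != B ->
  hyp2F1 A D B x =
  (A^-1)%g (1 - x) * hyp2F1 A (B * D^-1)%g B (x / (x - 1)).
Proof.
move=> x0 x1 D1 DB; have xB1 : x - 1 != 0 by rewrite subr_eq0.
have x1B : 1 - x != 0 by rewrite subr_eq0 eq_sym.
have BDB : (B * D^-1)%g != B.
  by rewrite -{2}[B]mulg1 (inj_eq (mulgI B)) eq_invg1.
have BD1 : (B * D^-1)%g != 1%g by rewrite -eq_mulgV1 eq_sym.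
rewrite !hyp2F1E ?mulf_neq0 ?invr_eq0 // !euler_sumE // euler_int_reflect //.
have -> : (B * D^-1 * B^-1)%g = (D^-1)%g.
  by rewrite [(B * _)%g]mulcharC -mulgA mulgV mulg1.
have invBD : ((B * D^-1)^-1)%g = (D * B^-1)%g by rewrite invgM invgK.
have e1 := gauss_gaussoV hpsi D; have e2 := gauss_gaussoV hpsi (B * D^-1)%g.
rewrite gausso_neq1 ?eq_invg1 // in e1.
rewrite gausso_neq1 ?eq_invg1 // invBD in e2.
have e3 : g (D * B^-1)%g = B (-1) * D (-1) * q / g (B * D^-1)%g.
  apply: (mulfI (gauss_neq0 hpsi (B * D^-1)%g)); rewrite e2.
  rewrite mulcharE mulcharVE mulcharN1V mulrC; field.
  exact: gauss_neq0.
have e4 : g (D^-1)%g = D (-1) * q / g D.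
  by apply: (mulfI (gauss_neq0 hpsi D)); rewrite e1; field; apply: gauss_neq0.
rewrite e3 e4 mulcharVE; have b2 := mulcharN1_sqr B.
set J := euler_int _ _ _ _; set K := A _.
transitivity (B (-1) * B (-1) * (D (-1) * B (-1) * (q - 1) * go B
  / (g A * g D * g (B * D^-1)%g * K) * J)).
  by field; rewrite card_neq0 !gauss_neq0 // mulchar_neq0.
by rewrite b2; field; rewrite card_neq0 !gauss_neq0 // mulchar_neq0.
Qed.

(** Evaluation of a Jacobi sum by Gauss sums, free of exceptional cases thanks to [gausst]: the
    substitution d -> d/b separates psi(b(1 + d/b)) into psi(b) psi(d). *)
Lemma beta_convolution A B :
  \sum_d B d * gt A (1 + d) = - (g (A * B^-1)%g * g B).
Proof.
rewrite /gausst; under eq_bigr do rewrite mulrN mulr_sumr.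
rewrite sumrN exchange_big; congr (- _).
have -> : g (A * B^-1)%g * g B =
   \sum_b (A * B^-1)%g b * psi b * \sum_d B d * psi d.
  by rewrite -mulr_suml /gauss mulrNN.
apply: eq_bigr => b _; have [->|b0] := eqVneq b 0.
  rewrite (mulchar0 (A * B^-1)%g) !mul0r big1 // => d _.
  by rewrite mulchar0 mul0r mulr0.
have bV : b^-1 != 0 by rewrite invr_eq0.
rewrite mulr_sumr (reindex_inj (mulfI bV)); apply: eq_bigr => d _.
have -> : b * (1 + b^-1 * d) = b + d by field.
rewrite mulcharM mulcharV (addcharD hpsi) mulcharE mulcharVE; field.
exact: mulchar_neq0.
Qed.

(** The trivial character only deletes a = 0, whose term would be g(A). In the completed sum, 1 + a
    = d(1 - x)/x gives 1 + ax = (1 - x)(1 + d), leaving a Jacobi sum. *)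
Lemma euler_int_1 A B x : x != 0 -> x != 1 ->
  euler_int A 1%g B x + g A =
  - (B ((1 - x) / x) * (A (1 - x))^-1 * (g (A * B^-1)%g * g B)).
Proof.
move=> x0 x1; have x1B : 1 - x != 0 by rewrite subr_eq0 eq_sym.
transitivity (\sum_a B (1 + a) * gt A (1 + a * x)).
  rewrite /euler_int invg1 mulg1; under eq_bigr do rewrite mulchar1E.
  rewrite [in RHS](bigD1 0) // mul0r addr0 mulchar1 mul1r gausst1 addrC.
  congr (_ + _); rewrite [LHS](bigD1 0) //= eqxx !mul0r add0r.
  by apply: eq_bigr => a ->; rewrite mul1r.
rewrite (reindex_inj (addrI (-1))).
have rx : (1 - x) / x != 0 by rewrite mulf_neq0 ?invr_eq0.
rewrite (reindex_inj (mulfI rx)) -mulrN -beta_convolution mulr_sumr.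
apply: eq_bigr => d _; rewrite addrA subrr add0r.
have -> : 1 + (-1 + (1 - x) / x * d) * x = (1 - x) * (1 + d) by field.
by rewrite gausstM // mulcharM; ring.
Qed.

(* Two terms produce the correction: [a = -1] in the sum on the right, where
   [gausst 1] deviates from the indicator of nonzero points, and [a = 0],
   which the sum on the left omits. *)
Lemma hyp2F1_pfaff_one A B x : x != 0 -> x != 1 -> B != 1%g ->
  hyp2F1 A 1%g B x =
  (A^-1)%g (1 - x) * hyp2F1 A B B (x / (x - 1))
  - (q - 1) ^+ 2 / q * (B ((1 - x) / x) * (A (1 - x))^-1
     * (g (A * B^-1)%g * g B) / g A).
Proof.
move=> x0 x1 B1; have xB1 : x - 1 != 0 by rewrite subr_eq0.
have x1B : 1 - x != 0 by rewrite subr_eq0 eq_sym.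
have := euler_int_1 A B x0 x1; set cor := (_ * (A _)^-1 * _) => core.
rewrite !hyp2F1E ?mulf_neq0 ?invr_eq0 // euler_sumE 1?eq_sym // mul1g gauss1 //.
have b2 := mulcharN1_sqr B.
have -> : euler_sum A B B (x / (x - 1)) =
   euler_int A B B (x / (x - 1)) + (1 - q) * B (-1) * A (1 - x) * g A.
  have -> : (1 - q) * B (-1) * A (1 - x) * g A = \sum_a (a == -1)%:R *
     ((1 - q) * B a * gt A (1 + a * (x / (x - 1)))).
    rewrite (bigD1 (-1)) //= eqxx mul1r.
    rewrite big1 ?addr0 => [|a /negPf ->]; last by rewrite mul0r.
    have -> : 1 + -1 * (x / (x - 1)) = (1 - x)^-1 * 1 by field; rewrite x1B.
    by rewrite gausstM ?invr_eq0 // gausst1 mulcharV invrK !mulrA.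
  rewrite /euler_sum /euler_int mulgV -big_split; apply: eq_bigr => a _.
  have a1 : (1 + a == 0) = (a == -1) by rewrite addrC addr_eq0.
  rewrite gausstE // eqxx gauss1 // mulchar1E a1.
  by case: (a == -1); rewrite /= ?invr0 ?invr1; ring.
have := euler_int_reflect A 1%g B x1; rewrite invg1 mulg1.
set J := euler_int _ _ _ _ in core *; set J' := euler_int _ _ _ _ => JJ.
have J'E : J' = B (-1) * A (1 - x) * J.
  rewrite JJ; transitivity (B (-1) * B (-1) * J'); first by rewrite b2 mul1r.
  by field; rewrite mulchar_neq0.
have gBV : g (B^-1)%g = B (-1) * q / g B.
  apply: (mulfI (gauss_neq0 hpsi B)).
  rewrite -[g (B^-1)%g]gausso_neq1 ?eq_invg1 // gauss_gaussoV //.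
  by field; apply: gauss_neq0.
(* With [cor] expressed this way, both sides are linear in [J] and g(A). On the right the g(A) terms
   cancel, and the coefficients of [J] add up to (q - 1)/g(A). *)
have corE : cor = - (J + g A) by rewrite core opprK.
rewrite corE J'E gBV (gausso_neq1 psi B1) mulcharVE.
set b := B (-1) in b2 *; set K := A _.
transitivity (b * b * ((q - 1) / g A * J)).
  by field; rewrite card_neq0 !gauss_neq0.
transitivity (b * b * (q - 1) / q / g A * (J + (1 - q) * g A)
    + (q - 1) ^+ 2 / q * ((J + g A) / g A)); last first.
  by field; rewrite card_neq0 !gauss_neq0 // mulchar_neq0.
by rewrite b2; field; rewrite card_neq0 !gauss_neq0.
Qed.

End Hypergeometric.

(** * Pochhammer symbols and the reduction of both double sums to 2F1 *)

Section Pochhammer.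
Variables (F : finFieldType) (C : numClosedFieldType) (psi : F -> C).
Hypothesis hpsi : nontrivial_additive_char psi.
Implicit Types (alpha beta gamma eta phi nu mu A D : mulchar F C) (x y : F).

Local Notation q := (#|F|%:R : C).
Local Notation g := (gauss psi).
Local Notation go := (gausso psi).

Lemma pocho1_neq0 A nu : pocho1 psi A nu != 0.
Proof. by rewrite mulf_neq0 ?invr_eq0 ?gausso_neq0. Qed.

Lemma poch1M A nu mu :
  poch1 psi A (nu * mu)%g = poch1 psi A mu * poch1 psi (A * mu)%g nu.
Proof.
rewrite /poch1 [(nu * mu)%g]mulcharC mulgA; field.
by rewrite !gauss_neq0.
Qed.

Lemma pocho1M A nu mu :
  pocho1 psi A (nu * mu)%g = pocho1 psi A mu * pocho1 psi (A * mu)%g nu.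
Proof.
rewrite /pocho1 [(nu * mu)%g]mulcharC mulgA; field.
by rewrite !gausso_neq0.
Qed.

Lemma gaussE phi : g phi = phi (-1) * q / go (phi^-1)%g.
Proof.
apply: (mulIf (gausso_neq0 hpsi (phi^-1)%g)).
by rewrite gauss_gaussoV // divfK ?gausso_neq0.
Qed.

(** Reflection is applied to both Gauss sums of the quotient; q and phi(-1) cancel, and only mu(-1)
    survives. *)
Lemma poch1_reflect phi mu :
  poch1 psi phi mu = mu (-1) / pocho1 psi (phi^-1)%g (mu^-1)%g.
Proof.
rewrite /poch1 /pocho1 !gaussE [(phi * mu)%g]mulcharC invgM mulcharE.
by field; rewrite card_neq0 !gausso_neq0 // mulchar_neq0 // oppr_eq0 oner_eq0.
Qed.

(** The cocycle rule (alpha)_(nu mu) = (alpha)_mu (alpha mu)_nu pulls the part depending on [mu]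
    alone out of the sum over [nu]. *)
Lemma sum_hyp2F1_l alpha beta gamma (f : mulchar F C -> C) x y :
  \sum_nu \sum_mu
     f mu * (poch1 psi alpha (nu * mu)%g * poch1 psi gamma (nu * mu)%g
             / (pocho1 psi beta (nu * mu)%g * pocho1 psi 1%g nu
                * pocho1 psi 1%g mu))
     * nu x * mu y
  = \sum_mu f mu * mu y * (poch1 psi alpha mu * poch1 psi gamma mu
             / (pocho1 psi beta mu * pocho1 psi 1%g mu))
     * hyp2F1 psi (alpha * mu)%g (gamma * mu)%g (beta * mu)%g x.
Proof.
rewrite exchange_big; apply: eq_bigr => mu _.
rewrite mulr_sumr; apply: eq_bigr => nu _.
by rewrite !poch1M pocho1M; field; rewrite !pocho1_neq0.
Qed.

Lemma sum_hyp2F1_r alpha beta gamma (f : mulchar F C -> C) x y :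
  x != 0 -> x != 1 ->
  (alpha^-1)%g (1 - x)
    * (\sum_eta
         poch psi (chargen alpha + chargen (beta * gamma^-1)%g) eta
         / pocho psi (chargen beta + chargen 1%g) eta
         * eta (x / (x - 1))
         * \sum_mu
             f mu
             * (poch psi (chargen (eta^-1)%g + chargen gamma) mu
                / pocho psi (chargen 1%g
                             + chargen (gamma * (beta * eta)^-1)%g) mu)
             * mu (- (y / x)))
  = \sum_mu f mu * mu y * (poch1 psi alpha mu * poch1 psi gamma mu
             / (pocho1 psi beta mu * pocho1 psi 1%g mu))
     * (((alpha * mu)^-1)%g (1 - x)
        * hyp2F1 psi (alpha * mu)%g (beta * gamma^-1)%g (beta * mu)%g
            (x / (x - 1))).
Proof.
move=> x0 x1; have x1B : 1 - x != 0 by rewrite subr_eq0 eq_sym.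
set D := (beta * gamma^-1)%g.
rewrite mulr_sumr; under eq_bigr do rewrite !mulr_sumr.
rewrite exchange_big; apply: eq_bigr => mu _.
(* With [mu] fixed, put eta = nu mu; the identity then holds term by term. *)
rewrite !mulr_sumr (reindex_inj (mulIg mu)); apply: eq_bigr => nu _.
rewrite !pochD !pochoD !poch_gen !pocho_gen.
have -> : (gamma * (beta * (nu * mu))^-1 = (D * (nu * mu))^-1)%g.
  rewrite (invgM beta) (invgM D) (invgM beta) invgK !mulgA.
  by rewrite [(gamma * _)%g]mulcharC.
rewrite [poch1 psi alpha _]poch1M [pocho1 psi beta _]pocho1M.
(* This form exposes the factor that cancels the symbol of gamma/(beta eta) in the inner
   denominator. *)
have -> : poch1 psi D (nu * mu)%g =
    mu (-1) * poch1 psi D nu * pocho1 psi ((D * (nu * mu))^-1)%g mu.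
  have e : pocho1 psi ((D * (nu * mu))^-1)%g mu =
      (pocho1 psi ((D * nu)^-1)%g (mu^-1)%g)^-1.
    rewrite /pocho1 invf_div mulgA !(invgM _ mu) [(mu^-1 * _)%g]mulcharC.
    by rewrite -mulgA mulVg mulg1.
  rewrite e.
  have -> : poch1 psi D (nu * mu)%g = poch1 psi D nu * poch1 psi (D * nu)%g mu.
    by rewrite [(nu * mu)%g]mulcharC poch1M.
  by rewrite [poch1 psi (D * nu)%g mu]poch1_reflect; ring.
(* Likewise the symbol of 1/eta trades the denominator at eta for the one at [nu]; the two signs
   mu(-1) cancel. *)
have -> : poch1 psi ((nu * mu)^-1)%g mu =
    mu (-1) * pocho1 psi 1%g (nu * mu)%g / pocho1 psi 1%g nu.
  rewrite poch1_reflect invgK /pocho1 !mul1g -mulgA mulgV mulg1.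
  by field; rewrite !gausso_neq0.
have -> : (nu * mu)%g (x / (x - 1)) = nu (x / (x - 1)) * (mu x / mu (x - 1)).
  by rewrite mulcharE [mu (_ / _)]mulcharM mulcharV.
rewrite [mu (- (y / x))]mulcharN [mu (y / x)]mulcharM [mu x^-1]mulcharV.
rewrite -(opprB 1 x) [mu (- (1 - x))]mulcharN.
rewrite !mulcharVE mulcharE.
have m2 := mulcharN1_sqr mu; set m := mu (-1) in m2 *.
rewrite -[RHS]mul1r -m2; field.
by rewrite !pocho1_neq0 // /m !mulchar_neq0 ?oppr_eq0 ?oner_eq0.
Qed.

End Pochhammer.

(** * Comparison of the coefficients of f(mu), with mu = gamma^-1 set apart *)

Theorem theorem3p17 (R : realType) (F : finFieldType) (psi : F -> R[i])
    (hpsi : nontrivial_additive_char psi)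
    (alpha beta gamma : mulchar F R[i])
    (h_alpha : charpair (chargen alpha) (chargen beta + chargen gamma) = 0%N)
    (h_beta : charpair (chargen beta) (chargen gamma) = 0%N)
    (f : mulchar F R[i] -> R[i])
    (x y : F) (hx0 : x <> 0) (hx1 : x <> 1) :
  \sum_(nu : mulchar F R[i]) \sum_(mu : mulchar F R[i])
     f mu * (poch1 psi alpha (nu * mu)%g * poch1 psi gamma (nu * mu)%g
             / (pocho1 psi beta (nu * mu)%g * pocho1 psi 1%g nu
                * pocho1 psi 1%g mu))
     * nu x * mu y
  = (alpha^-1)%g (1 - x)
    * (\sum_(eta : mulchar F R[i])
         poch psi (chargen alpha + chargen (beta * gamma^-1)%g) eta
         / pocho psi (chargen beta + chargen 1%g) eta
         * eta (x / (x - 1))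
         * \sum_(mu : mulchar F R[i])
             f mu
             * (poch psi (chargen (eta^-1)%g + chargen gamma) mu
                / pocho psi (chargen 1%g
                             + chargen (gamma * (beta * eta)^-1)%g) mu)
             * mu (- (y / x)))
    - (1 - #|F|%:R) ^+ 2 * f (gamma^-1)%g
      * (pocho1 psi 1%g beta / pocho1 psi (alpha^-1)%g beta)
      * (beta^-1 * gamma)%g (- x) * (gamma^-1)%g y
      * (alpha^-1 * beta)%g (1 - x).
Proof.
have x0 : x != 0 by apply/eqP.
have x1 : x != 1 by apply/eqP.
have x1B : 1 - x != 0 by rewrite subr_eq0 eq_sym.
have gb : gamma != beta.
  move: h_beta; rewrite charpair_gen /char_delta -eq_mulgV1 eq_sym.
  by case: eqP.
have BD mu : (beta * mu * (gamma * mu)^-1)%g = (beta * gamma^-1)%g.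
  by rewrite invgM mulgA mulgK.
rewrite sum_hyp2F1_l // sum_hyp2F1_r //.
(* At mu = gamma^-1 the parameter gamma mu is trivial. For all other mu, it differs from 1 and from
   beta mu, so Pfaff's transformation matches the terms. *)
rewrite (bigD1 (gamma^-1)%g) // [in RHS](bigD1 (gamma^-1)%g) //.
rewrite [X in _ + X = _](eq_bigr (fun mu => f mu * mu y
   * (poch1 psi alpha mu * poch1 psi gamma mu
             / (pocho1 psi beta mu * pocho1 psi 1%g mu))
     * (((alpha * mu)^-1)%g (1 - x)
        * hyp2F1 psi (alpha * mu)%g (beta * gamma^-1)%g (beta * mu)%g
            (x / (x - 1))))); last first.
  move=> mu muV; congr (_ * _); rewrite -(BD mu); apply: hyp2F1_pfaff => //.
    by rewrite mulcharC -{1}[gamma]invgK -eq_mulgV1.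
  by rewrite (inj_eq (mulIg mu)).
set S := \sum_(i | _) _; rewrite [RHS]addrAC; congr (_ + S).
rewrite mulgV hyp2F1_pfaff_one // -?eq_mulgV1 1?eq_sym //.
rewrite mulrBr; congr (_ - _).
have -> : (alpha * gamma^-1 * (beta * gamma^-1)^-1 = alpha * beta^-1)%g.
  by rewrite invgM invgK mulgA mulgKV.
have gB : gausso psi (beta * gamma^-1)%g = gauss psi (beta * gamma^-1)%g.
  by rewrite gausso_neq1 // -eq_mulgV1 eq_sym.
rewrite /poch1 /pocho1 mulgV gauss1 // !mul1g gausso1 // gB.
(* What remains is to match the two correction terms. Reflection expresses them through the Gauss
   sums of alpha, gamma, alpha/beta and beta, once those of alpha/gamma and beta/gamma cancel. *)
rewrite [gausso psi (gamma^-1)%g]gaussoE // [gausso psi (alpha^-1)%g]gaussoE //.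
rewrite [gausso psi (alpha^-1 * beta)%g]gaussoE // !invgM !invgK.
rewrite [(beta^-1 * alpha)%g]mulcharC.
set gy := (gamma^-1)%g y; rewrite !(mulcharE, mulcharVE) !mulcharN1V.
rewrite [beta (- x)]mulcharN [gamma (- x)]mulcharN.
rewrite ![_ ((1 - x) / x)]mulcharM ![_ x^-1]mulcharV.
have b2 := mulcharN1_sqr beta.
have c2 := mulcharN1_sqr gamma.
(* The sides differ by signs at -1; inserting gamma(-1)^2 = 1 and beta(-1)^2 = 1 makes the equality
   purely rational. *)
rewrite -[LHS]mul1r -[X in X * _ = _]c2 -[RHS]mul1r -[X in _ = X * _]b2; field.
rewrite card_neq0 !gauss_neq0 // gausso_neq0 // !mulchar_neq0 //.
all: by rewrite oppr_eq0 oner_eq0.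
Qed.
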